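(* Let $A\in\mathbb{C}^{m\times m}$ be non-singular, $p\in[1,\infty]$, $q\in[0,1]$, and let $\mathcal{Z}(A;p,q)\in\{0,1\}^{m\times m}$ be the $L_p$ norm based sparsity pattern of $A$. Then $$\min_{X} J(X;A)\le m^{1+2C}(1-q)^2\,\kappa(A)^2,$$ where the minimum is over all $X\in\mathbb{C}^{m\times m}$ satisfying the sparsity constraints $X_{ij}=0$ whenever $(\mathcal{Z}(A;p,q))_{ij}=0$, and $$C:=1-\frac1p+\left|\frac12-\frac1p\right|$$ (with $1/p=0$ for $p=\infty$).
   Context: For non-singular $A$, the misfit is $J(X;A)=\tfrac12\|(X-A)A^{-1}\|_F^2+\tfrac12\|A^{-1}(X-A)\|_F^2$ (Frobenius norms), and $\kappa(A)=\|A\|_2\|A^{-1}\|_2$ (spectral norms). Sparsity pattern $\mathcal{Z}(A;p,q)$. For a vector $x$ and $p\in[1,\infty]$, $\|x\|_p$ is the usual $\ell_p$ norm; $\|x\|_0$ is the number of nonzero entries; the empty vector has norm $0$. Vector pattern: given $x\in\mathbb{C}^k$ and an integer $N\ge0$, if $x=0$ the pattern is $0\in\{0,1\}^k$. Otherwise order indices so that $|x_{i_1}|\le\dots\le|x_{i_k}|$ (ties broken arbitrarily), let $z$ be the number of zero entries of $x$ and $N'=\min(N,\|x\|_0)$, and let $j$ be the largest integer in $\{z,\dots,k-N'\}$ with $\|(x_{i_1},\dots,x_{i_j})\|_p\le(1-q)\|x\|_p$. The pattern has entry $0$ at positions $i_1,\dots,i_j$ (eliminated entries) and $1$ at $i_{j+1},\dots,i_k$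 (preserved entries). Matrix pattern: for given nonnegative integers $N_{row},N_{col}$ (minimum numbers of nonzeros to keep in each row and column), apply the vector pattern to each row with $N=N_{row}$ and to each column with $N=N_{col}$; $(\mathcal{Z}(A;p,q))_{ij}=1$ if the row pattern or the column pattern (or both) has a $1$ at position $(i,j)$, and $0$ otherwise. *)

(* Defs.v *)
From mathcomp Require Import all_boot all_order all_algebra all_fingroup.
From mathcomp Require Import all_classical all_reals all_analysis.
From mathcomp Require Import complex.

Set Implicit Arguments.
Unset Strict Implicit.
Unset Printing Implicit Defensive.

Import Order.TTheory GRing.Theory Num.Theory.

Local Open Scope classical_set_scope.
Local Open Scope complex_scope.
Local Open Scope ring_scope.

Section Norms.
Variable R : realType.
Local Notation C := R[i].

(* A vector is given by the list of its entries, so that subvectors of any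
   length (including the empty one, of norm 0) are covered. The exponent is
   meant to satisfy 1 <= p; the value at -oo is junk. *)
Definition lpnorm (p : \bar R) (v : seq C) : R :=
  match p with
  | r%:E => (\sum_(c <- v) Normc.normc c `^ r) `^ r^-1
  | +oo%E => \big[Num.max/0]_(c <- v) Normc.normc c
  | -oo%E => 0
  end.

Definition row_entries (k : nat) (x : 'rV[C]_k) : seq C :=
  [seq x 0 i | i <- enum 'I_k].

Definition frobenius_norm (m n : nat) (M : 'M[C]_(m, n)) : R :=
  Num.sqrt (\sum_i \sum_j Normc.normc (M i j) ^+ 2).

Definition spectral_norm (m n : nat) (M : 'M[C]_(m, n)) : R :=
  sup [set lpnorm 2%:E (row_entries (M *m x)^T) |
        x in [set x : 'cV[C]_n | lpnorm 2%:E (row_entries x^T) <= 1]].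

Definition condition_number (m : nat) (A : 'M[C]_m) : R :=
  spectral_norm A * spectral_norm (invmx A).

Definition misfit (m : nat) (X A : 'M[C]_m) : R :=
  2^-1 * frobenius_norm ((X - A) *m invmx A) ^+ 2 +
  2^-1 * frobenius_norm (invmx A *m (X - A)) ^+ 2.

End Norms.

Section SparsityPattern.
Variable R : realType.
Local Notation C := R[i].

(* A permutation s encodes the index list i_1 = s 0, ..., i_k = s (k-1). Ties
   make the ordering non-unique, so patterns take the ordering as a parameter. *)
Definition orders_moduli (k : nat) (x : 'rV[C]_k) (s : 'S_k) : Prop :=
  forall a b : 'I_k, (a <= b)%N ->
    Normc.normc (x 0 (s a)) <= Normc.normc (x 0 (s b)).

Definition num_zeros (k : nat) (x : 'rV[C]_k) : nat := #|[pred i | x 0 i == 0]|.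

Definition l0norm (k : nat) (x : 'rV[C]_k) : nat := #|[pred i | x 0 i != 0]|.

Definition smallest_entries (k : nat) (x : 'rV[C]_k) (s : 'S_k) (j : nat) :
    seq C :=
  [seq x 0 (s a) | a <- take j (enum 'I_k)].

(* The maximum is over a nonempty set when s orders the moduli of x and q <= 1:
   j = num_zeros x always qualifies. *)
Definition num_eliminated (p : \bar R) (q : R) (N k : nat) (x : 'rV[C]_k)
    (s : 'S_k) : nat :=
  \max_(j < k.+1 |
      (num_zeros x <= j <= k - minn N (l0norm x))%N &&
      (lpnorm p (smallest_entries x s j) <= (1 - q) * lpnorm p (row_entries x)))
    j.

(* The (0-based) rank of index i in the ordering s is s^-1 i. *)
Definition vector_pattern (p : \bar R) (q : R) (N k : nat) (x : 'rV[C]_k)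
    (s : 'S_k) : 'rV[bool]_k :=
  if x == 0 then const_mx false
  else \row_i (num_eliminated p q N x s <= (s^-1)%g i)%N.

Definition sparsity_pattern (p : \bar R) (q : R) (Nrow Ncol m : nat)
    (A : 'M[C]_m) (srow scol : 'I_m -> 'S_m) : 'M[bool]_m :=
  \matrix_(i, j)
    (vector_pattern p q Nrow (row i A) (srow i) 0 j ||
     vector_pattern p q Ncol (col j A)^T (scol j) 0 i).

Definition satisfies_pattern (m : nat) (Z : 'M[bool]_m) (X : 'M[C]_m) : Prop :=
  forall i j, Z i j = false -> X i j = 0.

End SparsityPattern.

(* With the library convention +oo^-1 = 0 on \bar R. *)
Definition pattern_exponent (R : realType) (p : \bar R) : R :=
  1 - fine (p^-1)%E + `|2^-1 - fine (p^-1)%E|.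

(* Main.v *)
Require Import Defs.
From mathcomp Require Import all_boot all_order all_algebra all_fingroup.
From mathcomp Require Import all_classical all_reals all_analysis.
From mathcomp Require Import complex ring.

(** Let X0 keep the entries of A that the pattern preserves and be 0 elsewhere,
    and let E = X0 - A. It is enough to bound the misfit of X0, and to know that
    the minimum over the constrained matrices is attained.

    Bound. Each of the two terms of the misfit is at most half of
    ||A^-1||_2^2 ||E||_F^2 ([sqnorm_mulmxl_le], [sqnorm_mulmxr_le]). An entry
    of row i of E is nonzero only if the row pattern eliminates it, and the
    eliminated entries of row i have l_p norm at most 1 - q times that of the
    whole row. Passing from l_p to l_2 on one side and from l_2 to l_p on the
    other loses a factor m^|1/2 - 1/p| in total, because one of the two
    comparisons is free ([lpnorm2_le_transfer]). Summing the squares over the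
    rows,
      ||E||_F^2 <= (1 - q)^2 m^(2 |1/2 - 1/p|) ||A||_F^2
    ([sqnorm_restrict_sparsity_le]), while ||A||_F^2 <= m ||A||_2^2
    ([sqnorm_le_spectral]). The resulting exponent 1 + 2 |1/2 - 1/p| is at most
    1 + 2 C because 1 - 1/p >= 0. The column patterns can only preserve more
    entries.

    Attainment. The misfit of X is half the squared Euclidean norm of the vector
    ((X - A) A^-1, A^-1 (X - A)), so minimizing it over the matrices supported
    on the pattern is a linear least squares problem, whose normal equations
    always have a solution ([least_squares], [misfit_minimizer]). *)

Import Order.TTheory GRing.Theory Num.Theory.

Local Open Scope classical_set_scope.
Local Open Scope complex_scope.
Local Open Scope ring_scope.

(** * Comparison of l_p norms *)

Lemma normc_ge0 {R : realType} (c : R[i]) : 0 <= Normc.normc c.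
Proof. by case: c => a b; exact: sqrtr_ge0. Qed.

Lemma powR_rootK {R : realType} (r x : R) : 0 < r -> 0 <= x ->
  (x `^ r) `^ r^-1 = x.
Proof. by move=> r0 x0; rewrite -powRrM mulfV ?gt_eqF// powRr1. Qed.

Lemma lpnorm_ge0 {R : realType} (p : \bar R) (v : seq R[i]) : 0 <= lpnorm p v.
Proof.
case: p => [r| |] //=; first exact: powR_ge0.
by elim/big_rec: _ => // c x _ x0; rewrite le_max x0 orbT.
Qed.

Lemma lpnorm_nil {R : realType} (p : \bar R) : (1 <= p)%E ->
  lpnorm p ([::] : seq R[i]) = 0.
Proof.
case: p => [r| |] p1; [|by rewrite /= big_nil|by []].
have r0 : 0 < r by rewrite lee_fin in p1; exact: lt_le_trans p1.
by rewrite /lpnorm big_nil powR0 ?invr_eq0 ?gt_eqF.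
Qed.

Lemma sum_normc_ge0 {R : realType} (s : R) (v : seq R[i]) :
  0 <= \sum_(c <- v) Normc.normc c `^ s.
Proof. by apply: sumr_ge0 => c _; exact: powR_ge0. Qed.

Lemma lpnorm_powR {R : realType} (r : R) (v : seq R[i]) : 0 < r ->
  lpnorm r%:E v `^ r = \sum_(c <- v) Normc.normc c `^ r.
Proof.
by move=> r0; rewrite /= -powRrM mulVf ?gt_eqF// powRr1 ?sum_normc_ge0.
Qed.

Lemma normc_le_lpnorm {R : realType} (r : R) (v : seq R[i]) (c : R[i]) :
  0 < r -> c \in v -> Normc.normc c <= lpnorm r%:E v.
Proof.
move=> r0 cv; have nc0 := normc_ge0 c.
rewrite -[leLHS](powR_rootK _ _ r0)//=.
apply: ge0_ler_powR;
  rewrite ?nnegrE ?powR_ge0 ?sum_normc_ge0 ?invr_ge0 ?(ltW r0)//.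
rewrite (big_rem c cv)/= lerDl; exact: sum_normc_ge0.
Qed.

(** With N = ||v||_r, every entry satisfies |c| <= N, hence
    |c|^s <= |c|^r N^(s - r); summing gives ||v||_s^s <= N^s. *)
Lemma lpnorm_antitone {R : realType} (r s : R) (v : seq R[i]) :
  0 < r -> r <= s -> lpnorm s%:E v <= lpnorm r%:E v.
Proof.
move=> r0 rs; have s0 := lt_le_trans r0 rs; set N := lpnorm r%:E v.
have N0 : 0 <= N by exact: lpnorm_ge0.
have addK (x : R) : x `^ s = x `^ r * x `^ (s - r).
  by rewrite -powRD subrKC// gt_eqF.
rewrite -[leRHS](powR_rootK _ _ s0)//=.
apply: ge0_ler_powR; rewrite ?nnegrE ?invr_ge0 ?powR_ge0 ?(ltW s0)//.
  exact: sum_normc_ge0.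
rewrite addK lpnorm_powR// mulr_suml big_seq [leRHS]big_seq.
apply: ler_sum => c cv; rewrite addK ler_wpM2l ?powR_ge0//.
apply: ge0_ler_powR; rewrite ?nnegrE ?normc_ge0 ?subr_ge0//.
exact: normc_le_lpnorm.
Qed.

(** Young's inequality for x^r * 1 with exponents s/r and its conjugate: the
    concave power r/s lies below its tangent at 1. *)
Lemma powR_le_affine {R : realType} (r s x : R) : 0 < r -> r < s -> 0 <= x ->
  x `^ r <= (r / s) * x `^ s + (1 - r / s).
Proof.
move=> r0 rs x0; have s0 := lt_trans r0 rs.
have rs1 : 0 < 1 - r / s by rewrite subr_gt0 ltr_pdivrMr// mul1r.
have := @conjugate_powR R (x `^ r) 1 (s / r) (1 - r / s)^-1
  (powR_ge0 _ _) ler01.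
rewrite divr_gt0// invr_gt0 rs1 invf_div invrK subrKC.
move=> /(_ isT isT erefl); rewrite mulr1 powR1 mul1r -powRrM.
by rewrite [r * _]mulrC divfK ?gt_eqF// [X in _ <= X + _]mulrC.
Qed.

(** The power mean inequality. The bound [powR_le_affine] is summed over the
    entries of v / K, where K is such that their s-th powers add up to n. *)
Lemma lpnorm_le_power_mean {R : realType} (r s : R) (n : nat) (v : seq R[i]) :
  0 < r -> r <= s -> (size v <= n)%N ->
  lpnorm r%:E v <= n%:R `^ (r^-1 - s^-1) * lpnorm s%:E v.
Proof.
move=> r0; rewrite le_eqVlt => /predU1P[<- _|rs vn].
  by rewrite subrr powRr0 mul1r.
have s0 := lt_trans r0 rs.
have [S0|Spos] := eqVneq (lpnorm s%:E v) 0.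
  rewrite S0 mulr0 /= big_seq big1 ?powR0 ?invr_eq0 ?gt_eqF// => c cv.
  have : Normc.normc c <= 0 by rewrite -S0; exact: normc_le_lpnorm.
  by rewrite le_eqVlt ltNge normc_ge0 orbF => /eqP ->; rewrite powR0 ?gt_eqF.
have {}Spos : 0 < lpnorm s%:E v by rewrite lt_neqAle eq_sym Spos lpnorm_ge0.
have n0 : (0 < n%:R :> R).
  rewrite ltr0n; apply: leq_trans vn; case: v Spos => //=.
  by rewrite big_nil powR0 ?ltxx ?invr_eq0 ?gt_eqF.
set S := lpnorm s%:E v in Spos *.
(* K is the common modulus of n equal entries whose l_s norm is S. *)
pose K := n%:R `^ (- s^-1) * S.
have K0 : 0 < K by rewrite mulr_gt0// powR_gt0.
have Ks : K `^ s = n%:R^-1 * \sum_(c <- v) Normc.normc c `^ s.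
  rewrite powRM ?powR_ge0 ?(ltW Spos)// lpnorm_powR// -powRrM mulNr.
  by rewrite mulVf ?gt_eqF// powR_inv1 ?ler0n.
have divK t c : (Normc.normc c / K) `^ t = Normc.normc c `^ t / K `^ t.
  rewrite powRM ?normc_ge0 ?invr_ge0 ?(ltW K0)//.
  by rewrite -powR_inv1 ?(ltW K0)// -powRrM mulN1r powRN.
have sum_le : \sum_(c <- v) Normc.normc c `^ r <= n%:R * K `^ r.
  rewrite -ler_pdivrMr ?powR_gt0// mulr_suml.
  apply: (@le_trans _ _ (\sum_(c <- v)
      ((r / s) * (Normc.normc c `^ s / K `^ s) + (1 - r / s)))).
    apply: ler_sum => c _; rewrite -!divK; apply: powR_le_affine => //.
    by rewrite divr_ge0 ?normc_ge0 ?(ltW K0).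
  rewrite big_split/= -mulr_sumr -mulr_suml Ks big_const_seq count_predT
    iter_addr_0 -[X in _ + X <= _]mulr_natr.
  have T0 : \sum_(c <- v) Normc.normc c `^ s != 0.
    by rewrite -lpnorm_powR// gt_eqF// powR_gt0.
  rewrite [X in r / s * X](_ : _ = n%:R); last first.
    by rewrite invfM invrK mulrCA mulfV// mulr1.
  rewrite -[leRHS]mul1r -[X in _ <= X * _](subrKC (r / s)) [leRHS]mulrDl lerD2l.
  by rewrite ler_wpM2l ?ler_nat// subr_ge0 ler_pdivrMr// mul1r ltW.
rewrite powRD ?(gt_eqF n0) ?implybT// -mulrA -/K.
rewrite -[X in _ <= _ * X](powR_rootK _ _ r0) ?(ltW K0)//.
rewrite -powRM ?powR_ge0 ?ler0n//=.
by apply: ge0_ler_powR;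
  rewrite ?nnegrE ?sum_normc_ge0 ?invr_ge0 ?mulr_ge0 ?powR_ge0 ?ler0n ?(ltW r0).
Qed.

Lemma lpnorm_oo_le {R : realType} (r : R) (v : seq R[i]) : 0 < r ->
  lpnorm +oo%E v <= lpnorm r%:E v.
Proof.
move=> r0 /=; rewrite big_seq; apply: bigmax_le => [|c cv].
  exact: powR_ge0.
exact: normc_le_lpnorm.
Qed.

Lemma lpnorm_le_oo {R : realType} (r : R) (n : nat) (v : seq R[i]) :
  0 < r -> (size v <= n)%N ->
  lpnorm r%:E v <= n%:R `^ r^-1 * lpnorm +oo%E v.
Proof.
move=> r0 vn; set M := lpnorm +oo%E v; have M0 : 0 <= M by exact: lpnorm_ge0.
rewrite -[X in _ <= _ * X](powR_rootK _ _ r0)//.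
rewrite -powRM ?powR_ge0 ?ler0n//=.
apply: ge0_ler_powR; rewrite ?nnegrE ?sum_normc_ge0 ?invr_ge0 ?(ltW r0)//.
  by rewrite mulr_ge0 ?powR_ge0.
apply: (@le_trans _ _ (\sum_(c <- v) M `^ r)).
  rewrite big_seq [leRHS]big_seq; apply: ler_sum => c cv.
  apply: ge0_ler_powR; rewrite ?nnegrE ?normc_ge0 ?(ltW r0)//.
  exact: le_bigmax_seq.
by rewrite big_const_seq count_predT iter_addr_0 -[leLHS]mulr_natl
  ler_wpM2r ?powR_ge0 ?ler_nat.
Qed.

(** Of the two comparisons, l_2 by l_p for u and l_p by l_2 for v, only one
    costs a power of n: the first when p > 2, the second when p < 2. This is why
    the exponent is an absolute value. *)
Lemma lpnorm2_le_transfer {R : realType} (p : \bar R) (k : R) (n : nat)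
    (u v : seq R[i]) :
  (1 <= p)%E -> 0 <= k -> (size u <= n)%N -> (size v <= n)%N ->
  lpnorm p u <= k * lpnorm p v ->
  lpnorm 2%:E u <= k * n%:R `^ `|2^-1 - fine (p^-1)%E| * lpnorm 2%:E v.
Proof.
move=> p1 k0 un vn uv.
have n0 t : 0 <= n%:R `^ t :> R by exact: powR_ge0.
case: p p1 uv => [r| |] p1 uv; last by rewrite leeNy_eq in p1.
- rewrite lee_fin in p1; have r0 : 0 < r by exact: lt_le_trans p1.
  rewrite fine_invr.
  have [r2|r2] := leP r 2.
  + have /ger0_norm : 0 <= r^-1 - 2^-1 :> R by rewrite subr_ge0 lef_pV2 ?posrE.
    rewrite distrC => ->; apply: le_trans (lpnorm_antitone _ _ _ r0 r2) _.
    apply: le_trans uv _; rewrite -mulrA.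
    by apply: ler_wpM2l k0 _ _ _; exact: lpnorm_le_power_mean.
  + have /ger0_norm -> : 0 <= 2^-1 - r^-1 :> R.
      by rewrite subr_ge0 lef_pV2 ?posrE ?ltW.
    apply: le_trans (lpnorm_le_power_mean _ _ _ _ (ltr0n R 2) (ltW r2) un) _.
    rewrite -mulrA mulrCA; apply: ler_wpM2l (n0 _) _ _ _.
    apply: le_trans uv _; apply: ler_wpM2l k0 _ _ _.
    by apply: lpnorm_antitone (ltr0n R 2) _; exact: ltW.
- rewrite invey subr0 ger0_norm ?invr_ge0//.
  apply: le_trans (lpnorm_le_oo _ _ _ (ltr0n R 2) un) _.
  rewrite -mulrA mulrCA; apply: ler_wpM2l (n0 _) _ _ _.
  apply: le_trans uv _; apply: ler_wpM2l k0 _ _ _.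
  exact: lpnorm_oo_le.
Qed.

(** * The squared Frobenius norm *)

(** The squared Frobenius norm; on row and column vectors, the squared l_2
    norm. Working with squares avoids square roots until the spectral norm. *)
Definition sqnorm {R : realType} {m n : nat} (M : 'M[R[i]]_(m, n)) : R :=
  \sum_i \sum_j Normc.normc (M i j) ^+ 2.

Definition adjmx {R : realType} {m n : nat} (M : 'M[R[i]]_(m, n)) :
  'M[R[i]]_(n, m) := map_mx Num.conj M^T.

Lemma normcE {R : realType} (z : R[i]) : `|z| = (Normc.normc z)%:C.
Proof. by case: z. Qed.

Lemma normc_conj {R : realType} (z : R[i]) :
  Normc.normc (Num.conj z) = Normc.normc z.
Proof. by apply: (@complexI R); rewrite -!normcE norm_conjC. Qed.

Lemma sqnorm_ge0 {R : realType} {m n : nat} (M : 'M[R[i]]_(m, n)) :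
  0 <= sqnorm M.
Proof. by apply: sumr_ge0 => i _; apply: sumr_ge0 => j _; exact: sqr_ge0. Qed.

Lemma sqnorm_eq0 {R : realType} {m n : nat} (M : 'M[R[i]]_(m, n)) :
  sqnorm M = 0 -> M = 0.
Proof.
have row0 i : 0 <= \sum_j Normc.normc (M i j) ^+ 2.
  by apply: sumr_ge0 => j _; exact: sqr_ge0.
move=> M0; apply/matrixP => i j; rewrite mxE; apply: Normc.eq0_normc.
have Mi0 := @psumr_eq0P _ _ _ _ (fun i _ => row0 i) M0 i isT.
apply/eqP; rewrite -sqrf_eq0; apply/eqP.
exact: (@psumr_eq0P _ _ _ _ (fun j _ => sqr_ge0 _) Mi0 j isT).
Qed.

Lemma frobenius_sqr {R : realType} {m n : nat} (M : 'M[R[i]]_(m, n)) :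
  frobenius_norm M ^+ 2 = sqnorm M.
Proof. by rewrite sqr_sqrtr//; exact: sqnorm_ge0. Qed.

Lemma sqnorm_tr {R : realType} {m n : nat} (M : 'M[R[i]]_(m, n)) :
  sqnorm M^T = sqnorm M.
Proof.
rewrite /sqnorm exchange_big; apply: eq_bigr => i _.
by apply: eq_bigr => j _; rewrite mxE.
Qed.

Lemma sqnorm_adj {R : realType} {m n : nat} (M : 'M[R[i]]_(m, n)) :
  sqnorm (adjmx M) = sqnorm M.
Proof.
rewrite -[RHS]sqnorm_tr; apply: eq_bigr => i _; apply: eq_bigr => j _.
by rewrite [X in Normc.normc X]mxE normc_conj.
Qed.

Lemma sqnorm_rows {R : realType} {m n : nat} (M : 'M[R[i]]_(m, n)) :
  sqnorm M = \sum_i sqnorm (row i M).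
Proof.
apply: eq_bigr => i _; rewrite /sqnorm big_ord1.
by apply: eq_bigr => j _; rewrite mxE.
Qed.

Lemma sqnorm_cols {R : realType} {m n : nat} (M : 'M[R[i]]_(m, n)) :
  sqnorm M = \sum_j sqnorm (col j M).
Proof.
rewrite -sqnorm_tr sqnorm_rows; apply: eq_bigr => j _.
by rewrite -[RHS]sqnorm_tr tr_col.
Qed.

Lemma sqnorm_trace {R : realType} {m n : nat} (M : 'M[R[i]]_(m, n)) :
  (sqnorm M)%:C = \tr (M *m adjmx M).
Proof.
rewrite (rmorph_sum (real_complex R)); apply: eq_bigr => i _.
rewrite (rmorph_sum (real_complex R)) mxE; apply: eq_bigr => j _.
by rewrite !mxE rmorphXn/= -normcE normCK.
Qed.

Lemma adjmxM {R : realType} {m n k : nat} (M : 'M[R[i]]_(m, n))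
    (N : 'M[R[i]]_(n, k)) :
  adjmx (M *m N) = adjmx N *m adjmx M.
Proof. by rewrite /adjmx trmx_mul map_mxM. Qed.

Lemma adjmxD {R : realType} {m n : nat} (M N : 'M[R[i]]_(m, n)) :
  adjmx (M + N) = adjmx M + adjmx N.
Proof. by rewrite /adjmx raddfD map_mxD. Qed.

Lemma adjmxK {R : realType} {m n : nat} (M : 'M[R[i]]_(m, n)) :
  adjmx (adjmx M) = M.
Proof. by apply/matrixP => i j; rewrite !mxE conjCK. Qed.

Lemma pythagoras {R : realType} {m n : nat} (M N : 'M[R[i]]_(m, n)) :
  M *m adjmx N = 0 ->
  sqnorm (M + N) = sqnorm M + sqnorm N.
Proof.
move=> MN0; apply: (@complexI R); rewrite rmorphD/= !sqnorm_trace adjmxD.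
have NM0 : N *m adjmx M = 0.
  by rewrite -[N]adjmxK -adjmxM MN0 /adjmx trmx0 map_mx0.
by rewrite mulmxDl !mulmxDr MN0 NM0 addr0 add0r raddfD.
Qed.

Lemma sqnorm_mxvec {R : realType} {m n : nat} (M : 'M[R[i]]_(m, n)) :
  sqnorm (mxvec M) = sqnorm M.
Proof.
rewrite /sqnorm big_ord1 pair_bigA/=.
rewrite (reindex (uncurry (@mxvec_index m n))); last first.
  exact: curry_mxvec_bij.
by apply: eq_bigr => -[i j] _ /=; rewrite mxvecE.
Qed.

Lemma sqnorm_row_mx {R : realType} {m n1 n2 : nat} (M : 'M[R[i]]_(m, n1))
    (N : 'M[R[i]]_(m, n2)) :
  sqnorm (row_mx M N) = sqnorm M + sqnorm N.
Proof.
rewrite /sqnorm -big_split; apply: eq_bigr => i _; rewrite big_split_ord.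
by congr (_ + _); apply: eq_bigr => j _; rewrite (row_mxEl, row_mxEr).
Qed.

(** * Linear least squares *)

(** Writing M* for the adjoint, the normal equations (c M - b) M* = 0 have a
    solution because M M* and M* have the same row space: u M M* = 0 forces
    ||u M||^2 = 0, so the ranks agree. The residual of a solution is orthogonal
    to the row space of M, and [pythagoras] shows that it is shortest. *)
Lemma least_squares {R : realType} {k n : nat} (M : 'M[R[i]]_(k, n))
    (b : 'rV[R[i]]_n) :
  exists c : 'rV_k, forall d : 'rV_k,
    sqnorm (c *m M - b) <= sqnorm (d *m M - b).
Proof.
pose Ma := adjmx M.
have ker_sub : (kermx (M *m Ma) <= kermx M)%MS.
  apply/sub_kermxP; apply: sqnorm_eq0; apply: (@complexI R).
  by rewrite sqnorm_trace adjmxM -/Ma mulmxA -(mulmxA _ M) mulmx_ker mul0mx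
    raddf0.
have full : (Ma <= M *m Ma)%MS.
  rewrite -(mxrank_leqif_sup (submxMl M Ma)) eqn_leq mxrankM_maxr/=.
  rewrite /Ma /adjmx mxrank_map mxrank_tr -/(adjmx M) -/Ma.
  have := mxrankS ker_sub; rewrite !mxrank_ker leq_sub2lE ?rank_leq_row//.
have [c cE] : exists c, b *m Ma = c *m (M *m Ma).
  by have /submxP[c ->] := submx_trans (submxMl b Ma) full; exists c.
exists c => d.
have -> : d *m M - b = (c *m M - b) + (d - c) *m M.
  by rewrite mulmxBl [RHS]addrC addrA subrK.
rewrite (pythagoras (c *m M - b)) ?lerDl ?sqnorm_ge0//.
by rewrite adjmxM mulmxA mulmxBl -mulmxA -/Ma -cE subrr mul0mx.
Qed.

(** * Submultiplicativity of the Frobenius norm *)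

(** Lagrange's identity: twice the difference of the two sides is a sum of
    squares. *)
Lemma CauchySchwarz_sum {R : realType} {n : nat} (x y : 'I_n -> R) :
  (\sum_i x i * y i) ^+ 2 <= (\sum_i x i ^+ 2) * (\sum_i y i ^+ 2).
Proof.
rewrite -(ler_pM2l (ltr0n R 2)) -subr_ge0.
have -> : 2%:R * ((\sum_i x i ^+ 2) * (\sum_i y i ^+ 2)) -
    2%:R * (\sum_i x i * y i) ^+ 2 =
    \sum_i \sum_j (x i * y j - x j * y i) ^+ 2.
  transitivity (\sum_i \sum_j (x i ^+ 2 * y j ^+ 2 + y i ^+ 2 * x j ^+ 2
      - 2%:R * ((x i * y i) * (x j * y j)))).
    under [RHS]eq_bigr => i _.
      rewrite big_split big_split/= sumrN -!mulr_sumr.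
      over.
    rewrite big_split big_split/= sumrN -!mulr_sumr -!mulr_suml.
    ring.
  by apply: eq_bigr => i _; apply: eq_bigr => j _; ring.
by apply: sumr_ge0 => i _; apply: sumr_ge0 => j _; exact: sqr_ge0.
Qed.

Lemma normc_sum_mul {R : realType} {n : nat} (x y : 'I_n -> R[i]) :
  Normc.normc (\sum_i x i * y i) <=
  \sum_i Normc.normc (x i) * Normc.normc (y i).
Proof.
rewrite -lecR -normcE (rmorph_sum (real_complex R)).
apply: le_trans (ler_norm_sum _ _ _) _; apply: ler_sum => i _.
by rewrite normcE Normc.normcM.
Qed.

Lemma sqnormM_le {R : realType} {m n k : nat} (M : 'M[R[i]]_(m, n))
    (N : 'M[R[i]]_(n, k)) :
  sqnorm (M *m N) <= sqnorm M * sqnorm N.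
Proof.
rewrite -[sqnorm N]sqnorm_tr mulr_suml; apply: ler_sum => i _.
rewrite mulr_sumr; apply: ler_sum => j _; rewrite mxE.
apply: (@le_trans _ _
  ((\sum_l Normc.normc (M i l) * Normc.normc (N l j)) ^+ 2)).
  rewrite lerXn2r ?nnegrE ?normc_ge0 ?normc_sum_mul// sumr_ge0// => l _.
  by rewrite mulr_ge0 ?normc_ge0.
apply: le_trans (CauchySchwarz_sum _ _) _.
by under [X in _ <= _ * X]eq_bigr do rewrite mxE.
Qed.

(** * The spectral norm *)

Lemma lpnorm2_sum {R : realType} (v : seq R[i]) :
  lpnorm 2%:E v = Num.sqrt (\sum_(c <- v) Normc.normc c ^+ 2).
Proof.
rewrite /= powR12_sqrt ?sum_normc_ge0//; congr Num.sqrt.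
by apply: eq_bigr => c _; rewrite powR_mulrn ?normc_ge0.
Qed.

Lemma lpnorm2_row {R : realType} {n : nat} (x : 'rV[R[i]]_n) :
  lpnorm 2%:E (row_entries x) = Num.sqrt (sqnorm x).
Proof. by rewrite lpnorm2_sum big_map big_enum /sqnorm big_ord1. Qed.

Lemma lpnorm2_col {R : realType} {n : nat} (x : 'cV[R[i]]_n) :
  lpnorm 2%:E (row_entries x^T) = Num.sqrt (sqnorm x).
Proof. by rewrite lpnorm2_row sqnorm_tr. Qed.

Lemma sqnormZ {R : realType} {m n : nat} (a : R) (M : 'M[R[i]]_(m, n)) :
  0 <= a -> sqnorm (a%:C *: M) = a ^+ 2 * sqnorm M.
Proof.
move=> a0; rewrite mulr_sumr; apply: eq_bigr => i _.
rewrite mulr_sumr; apply: eq_bigr => j _; rewrite mxE Normc.normcM exprMn.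
congr (_ ^+ 2 * _); apply: (@complexI R); rewrite -normcE ger0_norm//.
by rewrite lecR.
Qed.

(** The Frobenius norm bounds the image of the unit ball. *)
Lemma has_sup_spectral {R : realType} {m n : nat} (M : 'M[R[i]]_(m, n)) :
  has_sup [set lpnorm 2%:E (row_entries (M *m x)^T) |
    x in [set x : 'cV[R[i]]_n | lpnorm 2%:E (row_entries x^T) <= 1]].
Proof.
split.
  exists (lpnorm 2%:E (row_entries (M *m 0)^T)), 0 => //.
  rewrite /mkset lpnorm2_col [X in Num.sqrt X](_ : _ = 0) ?sqrtr0//.
  by apply: big1 => i _; apply: big1 => j _; rewrite mxE Normc.normc0 expr0n.
exists (Num.sqrt (sqnorm M)) => _ [x x1 <-]; rewrite lpnorm2_col.
apply: ler_wsqrtr; apply: le_trans (sqnormM_le _ _) _.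
rewrite ler_piMr ?sqnorm_ge0//.
by move: x1; rewrite /mkset lpnorm2_col -{1}sqrtr1 ler_sqrt.
Qed.

Lemma spectral_norm_ge0 {R : realType} {m n : nat} (M : 'M[R[i]]_(m, n)) :
  0 <= spectral_norm M.
Proof.
have [[_ [x x1 _]] _] := has_sup_spectral M.
apply: (@le_trans _ _ (lpnorm 2%:E (row_entries (M *m x)^T))).
  exact: lpnorm_ge0.
by apply: sup_upper_bound (has_sup_spectral M) _ _; exists x.
Qed.

Lemma sqnorm_mulmx_col_le {R : realType} {m n : nat} (M : 'M[R[i]]_(m, n))
    (x : 'cV[R[i]]_n) :
  sqnorm (M *m x) <= spectral_norm M ^+ 2 * sqnorm x.
Proof.
have [x0|x0] := eqVneq (sqnorm x) 0.
  rewrite x0 mulr0 (sqnorm_eq0 _ x0) mulmx0 [leLHS](_ : _ = 0)//.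
  by apply: big1 => i _; apply: big1 => j _; rewrite mxE Normc.normc0 expr0n.
have {}x0 : 0 < sqnorm x by rewrite lt_neqAle eq_sym x0 sqnorm_ge0.
set a := Num.sqrt (sqnorm x); have a0 : 0 < a by rewrite sqrtr_gt0.
have aE : a ^+ 2 = sqnorm x by rewrite sqr_sqrtr ?ltW.
have ai0 : 0 <= a^-1 by rewrite invr_ge0 ltW.
have : lpnorm 2%:E (row_entries (M *m ((a^-1)%:C *: x))^T) <= spectral_norm M.
  apply: sup_upper_bound (has_sup_spectral M) _ _.
  exists ((a^-1)%:C *: x) => //.
  by rewrite /mkset lpnorm2_col sqnormZ// -aE exprVn mulVf ?sqrtr1//
    sqrf_eq0 gt_eqF.
rewrite lpnorm2_col -scalemxAr sqnormZ// => le_s.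
rewrite -aE -ler_pdivrMr ?exprn_gt0// mulrC -exprVn.
rewrite -[leLHS]sqr_sqrtr; last by rewrite mulr_ge0 ?sqr_ge0 ?sqnorm_ge0.
by rewrite lerXn2r ?nnegrE ?sqrtr_ge0 ?spectral_norm_ge0.
Qed.

Lemma sqnorm_mulmxl_le {R : realType} {m n k : nat} (M : 'M[R[i]]_(m, n))
    (N : 'M[R[i]]_(n, k)) :
  sqnorm (M *m N) <= spectral_norm M ^+ 2 * sqnorm N.
Proof.
rewrite !sqnorm_cols mulr_sumr; apply: ler_sum => j _.
by rewrite colE -mulmxA -colE; exact: sqnorm_mulmx_col_le.
Qed.

(** The spectral norm is defined by the action on columns; here N acts on
    rows. For a row e and y = e N, Cauchy-Schwarz gives
      ||y||^4 = |e (N y')|^2 <= ||e||^2 ||N y'||^2 <= ||e||^2 ||N||_2^2 ||y||^2,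
    where y' is the adjoint of y. *)
Lemma sqnorm_mulmxr_le {R : realType} {m n k : nat} (M : 'M[R[i]]_(m, n))
    (N : 'M[R[i]]_(n, k)) :
  sqnorm (M *m N) <= spectral_norm N ^+ 2 * sqnorm M.
Proof.
rewrite !sqnorm_rows mulr_sumr; apply: ler_sum => i _; rewrite row_mul.
set e := row i M; set y := e *m N.
have [y0|y0] := eqVneq (sqnorm y) 0.
  by rewrite y0 mulr_ge0 ?sqr_ge0 ?sqnorm_ge0.
have {}y0 : 0 < sqnorm y by rewrite lt_neqAle eq_sym y0 sqnorm_ge0.
rewrite -(ler_pM2r y0) -{1}[sqnorm y]mulr1.
have -> : sqnorm y * 1 * sqnorm y =
    sqnorm (y *m adjmx y).
  rewrite mulr1 /sqnorm !big_ord1 -/(sqnorm y).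
  have := sqnorm_trace y; rewrite /mxtrace big_ord1 => <-.
  rewrite -expr2; congr (_ ^+ 2); apply: (@complexI R); rewrite -normcE.
  by rewrite ger0_norm ?lecR ?sqnorm_ge0// /sqnorm big_ord1.
rewrite /y -mulmxA; apply: le_trans (sqnormM_le _ _) _.
rewrite -/y mulrAC [leRHS]mulrC ler_wpM2l ?sqnorm_ge0//.
by apply: le_trans (sqnorm_mulmx_col_le _ _) _; rewrite sqnorm_adj.
Qed.

(** M is M times the identity, whose squared Frobenius norm is n. *)
Lemma sqnorm_le_spectral {R : realType} {m n : nat} (M : 'M[R[i]]_(m, n)) :
  sqnorm M <= n%:R * spectral_norm M ^+ 2.
Proof.
rewrite -[M in leLHS]mulmx1 mulrC; apply: le_trans (sqnorm_mulmxl_le _ _) _.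
rewrite [X in _ * X](_ : _ = n%:R)//.
rewrite -[RHS]mulr1n -[n in RHS]card_ord -sumr_const; apply: eq_bigr => i _.
rewrite (bigD1 i)//= mxE eqxx Normc.normc1 expr1n big1 ?addr0// => j ji.
by rewrite mxE eq_sym (negbTE ji) Normc.normc0 expr0n.
Qed.

(** * The misfit over a sparsity pattern *)

Lemma misfitE {R : realType} {m : nat} (X A : 'M[R[i]]_m) :
  misfit X A = 2^-1 * (sqnorm ((X - A) *m invmx A) +
                       sqnorm (invmx A *m (X - A))).
Proof. by rewrite /misfit !frobenius_sqr mulrDr. Qed.

Definition pattern_restrict {R : realType} {m : nat} (Z : 'M[bool]_m)
    (X : 'M[R[i]]_m) : 'M[R[i]]_m :=
  \matrix_(i, j) if Z i j then X i j else 0.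

Lemma pattern_restrict_sat {R : realType} {m : nat} (Z : 'M[bool]_m)
    (X : 'M[R[i]]_m) : satisfies_pattern Z (pattern_restrict Z X).
Proof. by move=> i j Zij; rewrite mxE Zij. Qed.

Lemma pattern_restrict_id {R : realType} {m : nat} (Z : 'M[bool]_m)
    (X : 'M[R[i]]_m) : satisfies_pattern Z X -> pattern_restrict Z X = X.
Proof.
by move=> ZX; apply/matrixP => i j; rewrite mxE; case: ifPn => // /negbTE/ZX.
Qed.

(** On vectorized matrices, the projection to the matrices supported on Z is the
    diagonal matrix D below, and L is the map sending X to the pair
    (X A^-1, A^-1 X), so the problem is least squares for D L and the image of
    A under L. *)
Lemma misfit_minimizer {R : realType} {m : nat} (Z : 'M[bool]_m)
    (A : 'M[R[i]]_m) :
  exists2 X, satisfies_pattern Z X &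
    forall Y, satisfies_pattern Z Y -> misfit X A <= misfit Y A.
Proof.
pose B := invmx A.
pose D : 'M[R[i]]_(m * m) := diag_mx (mxvec (map_mx (fun z : bool => z%:R) Z)).
pose L : 'M[R[i]]_(m * m, m * m + m * m) :=
  row_mx (lin_mx (mulmxr B)) (lin_mx (mulmx B)).
have DE X : mxvec X *m D = mxvec (pattern_restrict Z X).
  apply/rowP => k; rewrite mul_mx_diag mxE.
  case/mxvec_indexP: k => i j; rewrite !mxvecE !mxE.
  by case: (Z i j); rewrite (mulr1, mulr0).
have LE X : mxvec X *m L = row_mx (mxvec (X *m B)) (mxvec (B *m X)).
  by rewrite mul_mx_row !mul_vec_lin.
have misfit_lsq X : misfit X A = 2^-1 * sqnorm (mxvec X *m L - mxvec A *m L).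
  by rewrite -mulmxBl -linearB LE sqnorm_row_mx !sqnorm_mxvec misfitE.
have [c min_c] := least_squares (D *m L) (mxvec A *m L).
exists (pattern_restrict Z (vec_mx c)); first exact: pattern_restrict_sat.
move=> Y ZY; rewrite !misfit_lsq ler_wpM2l ?invr_ge0//.
rewrite -DE vec_mxK -(pattern_restrict_id Z Y ZY) -DE -!(mulmxA _ D).
exact: min_c.
Qed.

Lemma misfit_le {R : realType} {m : nat} (X A : 'M[R[i]]_m) :
  misfit X A <= spectral_norm (invmx A) ^+ 2 * sqnorm (X - A).
Proof.
rewrite misfitE ler_pdivrMl// mulr_natl mulr2n.
by apply: lerD; [exact: sqnorm_mulmxr_le | exact: sqnorm_mulmxl_le].
Qed.

(** * The entries eliminated by the pattern *)

(** The defining inequality holds at the maximum, including when no index is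
    eligible: the maximum is then 0 and the empty vector has norm 0. *)
Lemma lpnorm_num_eliminated {R : realType} (p : \bar R) (q : R) (N k : nat)
    (x : 'rV[R[i]]_k) (s : 'S_k) : (1 <= p)%E -> q <= 1 ->
  lpnorm p (smallest_entries x s (num_eliminated p q N x s)) <=
    (1 - q) * lpnorm p (row_entries x).
Proof.
move=> p1 q1; pose Q j := lpnorm p (smallest_entries x s j) <=
  (1 - q) * lpnorm p (row_entries x).
apply: (big_ind Q) => [|i j Qi Qj|j /andP[]//]; last first.
  by rewrite /maxn; case: ifP.
rewrite /Q /smallest_entries take0 [lpnorm p _](_ : _ = 0).
  by rewrite mulr_ge0 ?lpnorm_ge0 ?subr_ge0.
exact: lpnorm_nil.
Qed.

Lemma take_enum_ord (k j : nat) :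
  take j (enum 'I_k) = [seq a : 'I_k <- enum 'I_k | (a < j)%N].
Proof.
apply: (inj_map val_inj); rewrite map_take val_enum_ord.
rewrite -(filter_map val (fun a => (a < j)%N)) val_enum_ord.
rewrite take_iota -(filter_iota_ltn 0 (geq_minr j k)) add0n.
apply: eq_in_filter => a; rewrite mem_iota add0n => /= ak.
by rewrite leq_min ak andbT.
Qed.

(** Reindexing by s turns the eliminated positions into the first entries in
    the ordering, to which [lpnorm_num_eliminated] applies. *)
Lemma eliminated_sqnorm_le {R : realType} (p : \bar R) (q : R) (N k : nat)
    (x : 'rV[R[i]]_k) (s : 'S_k) : (1 <= p)%E -> q <= 1 ->
  \sum_(j | ~~ vector_pattern p q N x s 0 j) Normc.normc (x 0 j) ^+ 2 <=
    ((1 - q) * k%:R `^ `|2^-1 - fine (p^-1)%E|) ^+ 2 * sqnorm x.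
Proof.
move=> p1 q1; have q0 : 0 <= 1 - q by rewrite subr_ge0.
have [->|x0] := eqVneq x 0.
  rewrite big1 ?mulr_ge0 ?sqr_ge0 ?sqnorm_ge0// => j _.
  by rewrite mxE Normc.normc0 expr0n.
set e := num_eliminated p q N x s.
pose u := smallest_entries x s e.
have -> : \sum_(j | ~~ vector_pattern p q N x s 0 j) Normc.normc (x 0 j) ^+ 2 =
    \sum_(c <- u) Normc.normc c ^+ 2.
  rewrite big_map take_enum_ord big_filter big_enum_cond/=.
  rewrite (reindex_inj (@perm_inj _ s)); apply: eq_bigl => a.
  by rewrite /vector_pattern (negbTE x0) mxE permK -ltnNge.
have u2 : lpnorm 2%:E u <=
    (1 - q) * k%:R `^ `|2^-1 - fine (p^-1)%E| * lpnorm 2%:E (row_entries x).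
  apply: lpnorm2_le_transfer => //.
  - by rewrite size_map size_take_min size_enum_ord geq_minr.
  - by rewrite size_map size_enum_ord.
  - exact: lpnorm_num_eliminated.
have S0 : 0 <= \sum_(c <- u) Normc.normc c ^+ 2.
  by apply: sumr_ge0 => c _; exact: sqr_ge0.
rewrite -[leLHS]sqr_sqrtr// -[sqnorm x]sqr_sqrtr ?sqnorm_ge0// -exprMn.
rewrite -lpnorm2_sum -lpnorm2_row lerXn2r ?nnegrE ?lpnorm_ge0//.
by rewrite !mulr_ge0 ?powR_ge0 ?lpnorm_ge0.
Qed.

(** A nonzero entry of the difference is eliminated by its row pattern, so the
    estimate for single rows can be summed. *)
Lemma sqnorm_restrict_sparsity_le {R : realType} {m : nat} (A : 'M[R[i]]_m)
    (p : \bar R) (q : R) (Nrow Ncol : nat) (srow scol : 'I_m -> 'S_m) :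
  (1 <= p)%E -> q <= 1 ->
  sqnorm (pattern_restrict (sparsity_pattern p q Nrow Ncol A srow scol) A - A)
    <= ((1 - q) * m%:R `^ `|2^-1 - fine (p^-1)%E|) ^+ 2 * sqnorm A.
Proof.
move=> p1 q1; rewrite [sqnorm A]sqnorm_rows mulr_sumr; apply: ler_sum => i _.
apply: le_trans (eliminated_sqnorm_le p q Nrow m (row i A) (srow i) p1 q1).
rewrite [leRHS]big_mkcond; apply: ler_sum => j _; rewrite !mxE.
case: (vector_pattern _ _ _ (row i A) _ 0 j) => /=.
  by rewrite subrr Normc.normc0 expr0n.
by case: ifP => _; rewrite ?subrr ?sub0r ?Normc.normc0 ?normcN ?expr0n ?sqr_ge0.
Qed.

(** * The bound on the minimal misfit *)

Theorem theorem4p4 (R : realType) (m : nat) (A : 'M[R[i]]_m)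
    (p : \bar R) (q : R) (Nrow Ncol : nat) (srow scol : 'I_m -> 'S_m)
    (A_unit : A \in unitmx)
    (p_ge1 : (1 <= p)%E) (q_ge0 : 0 <= q) (q_le1 : q <= 1)
    (srow_ord : forall i : 'I_m, orders_moduli (row i A) (srow i))
    (scol_ord : forall j : 'I_m, orders_moduli (col j A)^T (scol j)) :
  let Z := sparsity_pattern p q Nrow Ncol A srow scol in
  exists X : 'M[R[i]]_m,
    [/\ satisfies_pattern Z X,
        forall Y : 'M[R[i]]_m, satisfies_pattern Z Y ->
          misfit X A <= misfit Y A
      & misfit X A <=
          m%:R `^ (1 + 2 * pattern_exponent p) * (1 - q) ^+ 2 *
          condition_number A ^+ 2].
Proof.
move=> Z; have [X ZX minX] := misfit_minimizer Z A.
exists X; split=> //.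
apply: le_trans (minX _ (pattern_restrict_sat Z A)) _.
apply: le_trans (misfit_le _ _) _.
rewrite /condition_number exprMn [X in _ <= _ * X]mulrC mulrCA.
rewrite ler_wpM2l ?sqr_ge0//.
(* The powers of m increase with the exponent only when m >= 1. *)
case: (posnP m) => [m0|m_gt0].
  rewrite [leLHS](_ : _ = 0); first
    by rewrite mulr_ge0 ?sqr_ge0// mulr_ge0 ?sqr_ge0 ?powR_ge0.
  by apply: big1 => i _; have := ltn_ord i; rewrite [X in (_ < X)%N]m0.
apply: le_trans (sqnorm_restrict_sparsity_le _ _ _ _ _ _ _ p_ge1 q_le1) _.
set e := `|2^-1 - fine (p^-1)%E|.
have m1 : 1 <= m%:R :> R by rewrite ler1n.
have m_neq0 : m%:R != 0 :> R by rewrite pnatr_eq0 -lt0n.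
have pinv_le1 : fine (p^-1)%E <= 1.
  case: p p_ge1 {Z X ZX minX e} => [r| |] p1 //.
  move: p1; rewrite lee_fin fine_invr => r1.
  by rewrite invf_le1 ?(lt_le_trans ltr01 r1).
have le_pow : m%:R * (m%:R `^ e) ^+ 2 <= m%:R `^ (1 + 2 * pattern_exponent p).
  rewrite -powR_mulrn ?powR_ge0// -powRrM -[X in X * _]powRr1 ?ler0n//.
  rewrite -powRD ?m_neq0 ?implybT//; apply: ler_powR => //.
  by rewrite lerD2l mulrC ler_wpM2l// /pattern_exponent lerDr subr_ge0.
rewrite exprMn.
apply: (@le_trans _ _ (((1 - q) ^+ 2 * (m%:R `^ e) ^+ 2) *
    (m%:R * spectral_norm A ^+ 2))).
  apply: ler_wpM2l; last exact: sqnorm_le_spectral.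
  by apply: mulr_ge0; exact: sqr_ge0.
rewrite mulrA ler_wpM2r ?sqr_ge0// -mulrA mulrC ler_wpM2r ?sqr_ge0//.
by rewrite mulrC.
Qed.
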